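(* Assume $\alpha>\beta+1$, $\beta\ge0$, $\theta>0$, and let $f(u)=u$. For $\rho>0$ let $u(\cdot,\rho)$ be the solution on $[0,\infty)$ of $L(u)+e^{u}=0$, $u(0)=\rho$, $u'(0)=0$, let $R(0,\rho)$ be its unique positive zero, $\lambda(\rho)=R(0,\rho)^\theta$ and $u_{\lambda(\rho)}(r)=u(\lambda(\rho)^{1/\theta}r,\rho)$. Let $u^*(r)=\ln\{\theta^{\beta+1}(\alpha-\beta-1)\}-\theta\ln r$, $\lambda^*=\theta^{\beta+1}(\alpha-\beta-1)$, $u^*_{\lambda^*}(r)=-\theta\ln r$. Then, as $\rho\to+\infty$, $u(\cdot,\rho)\to u^*$ uniformly on compact subsets of $(0,\infty)$, $\lambda(\rho)\to\lambda^*$, and $u_{\lambda(\rho)}\to u^*_{\lambda^*}$ uniformly on compact subsets of $(0,\infty)$.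
   Context: $L(u)(r)=r^{-\gamma}(r^{\alpha}|u'(r)|^{\beta}u'(r))'$ and $\theta=\gamma+2+\beta-\alpha$. $(u_{\lambda(\rho)},\lambda(\rho))$ is the regular solution of $L(u)+\lambda e^u=0$ on $[0,1]$, $u'(0)=u(1)=0$, with $u(0)=\rho$; $u^*$ and $u^*_{\lambda^*}$ are the singular solutions of $L(u)+e^u=0$ and of $L(u)+\lambda^*e^u=0$, $u(1)=0$, respectively. *)

(* Defs.v *)
From Stdlib Require Import Reals.
From Coquelicot Require Import Coquelicot.
Open Scope R_scope.

Definition phi (beta v : R) : R :=
  if Req_EM_T v 0 then 0 else Rpower (Rabs v) beta * v.

(* u is a solution on [0,oo) of
     r^{-gamma} (r^alpha |u'|^beta u')' + e^u = 0,  u(0) = rho, u'(0) = 0,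
   where u'(0) is the right derivative at 0, u is differentiable on (0,oo)
   and the flux r^alpha phi_beta(u'(r)) is differentiable on (0,oo). *)
Definition is_sol_ivp (alpha beta gamma rho : R) (u : R -> R) : Prop :=
  u 0 = rho /\
  filterlim (fun h => (u h - u 0) / h) (at_right 0) (locally 0) /\
  (forall r, 0 < r -> ex_derive u r) /\
  (forall r, 0 < r ->
     is_derive (fun s => Rpower s alpha * phi beta (Derive u s)) r
               (- (Rpower r gamma * exp (u r)))).

Definition cvg_loc_unif_pinfty (F : R -> R -> R) (g : R -> R) : Prop :=
  forall a b, 0 < a -> a <= b ->
  forall eps, 0 < eps ->
  exists M, forall rho, M < rho ->
  forall r, a <= r <= b -> Rabs (F rho r - g r) < eps.

(* Main.v *)
Require Import Defs.
From Stdlib Require Import Reals Lra.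
From Coquelicot Require Import Coquelicot.
Open Scope R_scope.

(** With [p = beta + 1], [kappa = alpha - p], [t = ln r],
    [x = u - u*] and [Z = (- r u')^p] the equation becomes autonomous:
      [x' = theta - Z^(1/p)],  [Z' = kappa theta^p e^x - kappa Z].
    The energy [E = kappa theta^p (e^x - 1 - x) + g(Z)], where
    [g' (Z) = Z^(1/p) - theta] and [g (theta^p) = 0], is nonincreasing, and
    for small [eps] the functional [F = E - eps x (Z - theta^p)] satisfies
    [F' <= - c E] on sublevel sets of [E].  Hence [E(t) <= C / (t - t0)] with
    [C] depending only on a bound for [E(t0)].  At [t0 = - rho / theta] the
    regular solution with [u(0) = rho] has [x] and [Z] bounded independently
    of [rho], so [u - u*] is uniformly small for [ln r >= T - rho / theta].
    This avoids any use of uniqueness or scaling of regular solutions.  The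
    statements on [lambda(rho)] follow by evaluating at the zero of [u]. *)

(** * Real powers, mean value estimates and bounds for the exponential *)

Lemma is_derive_Rpower (a x : R) :
  0 < x -> is_derive (fun y => Rpower y a) x (a * Rpower x (a - 1)).
Proof. intros Hx. apply is_derive_Reals, derivable_pt_lim_power, Hx. Qed.

Lemma Rpower_gt_0 (x a : R) : 0 < Rpower x a.
Proof. apply exp_pos. Qed.

Lemma Rpower_inv_l (x a : R) : a <> 0 -> 0 < x -> Rpower (Rpower x a) (/ a) = x.
Proof.
  intros Ha Hx. rewrite Rpower_mult, Rinv_r by exact Ha. now apply Rpower_1.
Qed.

Lemma Rpower_inv_r (x a : R) : a <> 0 -> 0 < x -> Rpower (Rpower x (/ a)) a = x.
Proof.
  intros Ha Hx. rewrite Rpower_mult, Rinv_l by exact Ha. now apply Rpower_1.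
Qed.

Lemma increment_le (f df : R -> R) (k a b : R) :
  a <= b ->
  (forall t, a <= t <= b -> is_derive f t (df t)) ->
  (forall t, a <= t <= b -> df t <= k) ->
  f b - f a <= k * (b - a).
Proof.
  intros Hab Hd Hk.
  destruct (MVT_gen f a b df) as [c [Hc Heq]].
  - intros x Hx. rewrite Rmin_left, Rmax_right in Hx by lra. apply Hd; lra.
  - intros x Hx. rewrite Rmin_left, Rmax_right in Hx by lra.
    apply continuity_pt_filterlim, (ex_derive_continuous f).
    eexists. apply Hd; lra.
  - rewrite Rmin_left, Rmax_right in Hc by lra.
    rewrite Heq. apply Rmult_le_compat_r; [lra|]. now apply Hk.
Qed.

(** Stated for [a] and [b] in either order, since [Z] may lie on either side of its equilibrium
    $\theta^p$. *)
Lemma MVT_pos (f df : R -> R) (a b : R) :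
  0 < a -> 0 < b -> (forall t, 0 < t -> is_derive f t (df t)) ->
  exists c, 0 < c /\ (a <= c <= b \/ b <= c <= a) /\ f b - f a = df c * (b - a).
Proof.
  intros Ha Hb Hd.
  assert (Hm : 0 < Rmin a b) by now apply Rmin_glb_lt.
  destruct (MVT_gen f a b df) as [c [Hc Heq]].
  - intros x Hx. apply Hd; lra.
  - intros x Hx. apply continuity_pt_filterlim, (ex_derive_continuous f).
    eexists. apply Hd; lra.
  - exists c. split; [lra|]. split; [|exact Heq].
    unfold Rmin, Rmax in Hc. destruct (Rle_dec a b); lra.
Qed.

(** For $x \ge -2$, square $e^{x/2} \ge 1 + x/2 \ge 0$; for $x < -2$ the part $-1-x$ alone exceeds
    1. This converts small energy into small $|x|$. *)
Lemma exp_ineq_quad (x : R) : Rmin (x ^ 2 / 4) 1 <= exp x - 1 - x.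
Proof.
  destruct (Rle_dec (-2) x) as [H|H].
  - apply Rle_trans with (x ^ 2 / 4); [apply Rmin_l|].
    assert (H1 := exp_ineq1_le (x / 2)).
    replace x with (x / 2 + x / 2) at 2 by field. rewrite exp_plus. nra.
  - apply Rle_trans with 1; [apply Rmin_r|].
    assert (H1 := exp_pos x). lra.
Qed.

(** $e^x - 1 = x e^c$ with $c$ between $0$ and $x$, hence $c \ge -X$. *)
Lemma exp_minus_1_lower (x X : R) :
  0 <= X -> - X <= x -> exp (- X) * x ^ 2 <= x * (exp x - 1).
Proof.
  intros HX Hx.
  destruct (MVT_gen exp 0 x exp) as [c [Hc Heq]].
  - intros y _. apply is_derive_Reals, derivable_pt_lim_exp.
  - intros y _. apply derivable_continuous_pt, derivable_pt_exp.
  - rewrite exp_0 in Heq. rewrite Heq.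
    replace (x * (exp c * (x - 0))) with (exp c * x ^ 2) by ring.
    apply Rmult_le_compat_r; [apply pow2_ge_0|].
    assert (HcX : - X <= c).
    { apply Rle_trans with (Rmin 0 x); [apply Rmin_glb; lra | apply Hc]. }
    destruct HcX as [H|H]; [left; now apply exp_increasing | rewrite H; lra].
Qed.

(** * The convex potential in [Z] *)

Definition potential (p theta Z : R) : R :=
  p / (p + 1) * (Rpower Z (1 + / p) - Rpower (Rpower theta p) (1 + / p))
  - theta * (Z - Rpower theta p).

Lemma is_derive_potential (p theta Z : R) :
  1 <= p -> 0 < Z ->
  is_derive (potential p theta) Z (Rpower Z (/ p) - theta).
Proof.
  intros Hp HZ. unfold potential.
  evar_last.
  - apply (is_derive_minus (fun Z => p / (p + 1) * (Rpower Z (1 + / p) - Rpower (Rpower theta p) (1 + / p)))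
       (fun Z => theta * (Z - Rpower theta p))).
    + apply (is_derive_scal (fun Z => Rpower Z (1 + / p) - Rpower (Rpower theta p) (1 + / p))).
      apply (is_derive_minus (fun Z => Rpower Z (1 + / p)) (fun _ => Rpower (Rpower theta p) (1 + / p))).
      * now apply is_derive_Rpower.
      * apply is_derive_const.
    + auto_derive; [exact I | reflexivity].
  - unfold minus, plus, opp, zero; simpl.
    replace (1 + / p - 1) with (/ p) by ring.
    field. lra.
Qed.

(** The derivative $Z^{1/p} - \theta$ is increasing and vanishes at $\theta^p$, so the potential is
    convex with minimum $0$ there, and its increment is at most the end slope times the
    displacement. The upper bound times [kappa] is the dissipation rate of the energy. *)
Lemma potential_bounds (p theta Z : R) :
  1 <= p -> 0 < theta -> 0 < Z ->
  0 <= potential p theta Z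
    <= (Rpower Z (/ p) - theta) * (Z - Rpower theta p).
Proof.
  intros Hp Ht HZ.
  assert (Hip : 0 < / p) by (apply Rinv_0_lt_compat; lra).
  assert (Hr : Rpower (Rpower theta p) (/ p) = theta) by (apply Rpower_inv_l; lra).
  assert (Hs := Rpower_gt_0 theta p).
  destruct (MVT_pos (potential p theta) (fun s => Rpower s (/ p) - theta)
              (Rpower theta p) Z) as [c [Hc0 [Hc Heq]]]; auto.
  { intros t Htp. now apply is_derive_potential. }
  assert (H0 : potential p theta (Rpower theta p) = 0) by (unfold potential; ring).
  rewrite H0, Rminus_0_r in Heq. rewrite Heq.
  destruct Hc as [Hc|Hc].
  - assert (H1 := Rle_Rpower_l (Rpower theta p) c (/ p) ltac:(lra) ltac:(lra)).
    assert (H2 := Rle_Rpower_l c Z (/ p) ltac:(lra) ltac:(lra)).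
    split; [apply Rmult_le_pos; lra | apply Rmult_le_compat_r; lra].
  - assert (H1 := Rle_Rpower_l c (Rpower theta p) (/ p) ltac:(lra) ltac:(lra)).
    assert (H2 := Rle_Rpower_l Z c (/ p) ltac:(lra) ltac:(lra)).
    rewrite <- (Rmult_opp_opp (_ - _) (Z - _)), <- (Rmult_opp_opp (Rpower Z _ - _)).
    split; [apply Rmult_le_pos; lra | apply Rmult_le_compat_r; lra].
Qed.

(** With $m = Z^{1/p}$ and $q = 1/(p+1) \le 1/2$, the potential is $Z((1-q)m - \theta)$ plus a
    nonnegative constant. A larger $m$ would force $Z \ge 1$ and a potential of at least $K +
    1/2$. *)
Lemma potential_coercive (p theta Z K : R) :
  1 <= p -> 0 < theta -> 0 < Z -> 0 <= K -> potential p theta Z <= K ->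
  Rpower Z (/ p) <= 1 + 2 * (theta + K).
Proof.
  intros Hp Ht HZ HK H.
  assert (Hp1 : p / (p + 1) = 1 - / (p + 1)) by (field; lra).
  assert (Hq : 0 < / (p + 1) <= / 2).
  { split; [apply Rinv_0_lt_compat; lra | apply Rinv_le_contravar; lra]. }
  assert (Hm := Rpower_gt_0 Z (/ p)).
  assert (E1 : Rpower Z (1 + / p) = Z * Rpower Z (/ p)).
  { now rewrite Rpower_plus, Rpower_1. }
  assert (E2 : Rpower (Rpower theta p) (1 + / p) = Rpower theta p * theta).
  { rewrite Rpower_plus, Rpower_1, Rpower_inv_l by (try lra; apply Rpower_gt_0); reflexivity. }
  unfold potential in H. rewrite E1, E2, Hp1 in H.
  assert (Hs := Rpower_gt_0 theta p).
  set (m := Rpower Z (/ p)) in *. set (q := / (p + 1)) in *.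
  set (Zs := Rpower theta p) in *.
  assert (HmZ : 1 < m -> 1 <= Z).
  { intros Hm1. replace Z with (Rpower m p) by (apply Rpower_inv_r; lra).
    rewrite <- (Rpower_O m) by lra. apply Rle_Rpower; lra. }
  destruct (Rle_dec m (1 + 2 * (theta + K))) as [|Hn]; [assumption|exfalso].
  assert (H1 : 1 <= Z) by (apply HmZ; lra).
  assert (H2 : Z * ((1 - q) * m - theta) <= K).
  { assert (0 <= q * (Zs * theta)) by (apply Rmult_le_pos; [lra|apply Rmult_le_pos; lra]).
    replace (Z * ((1 - q) * m - theta)) with
     ((1 - q) * (Z * m - Zs * theta) - theta * (Z - Zs) - q * (Zs * theta)) by ring. lra. }
  assert (H3 : K + / 2 <= (1 - q) * m - theta) by nra.
  assert (H4 : (1 - q) * m - theta <= Z * ((1 - q) * m - theta)) by nra.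
  lra.
Qed.

(** $b^p - a^p = p c^{p-1}(b-a)$ with $c \le L$. Used with $a = \theta$, $b = Z^{1/p}$, to bound
    $(Z-\theta^p)^2$ by the dissipation. *)
Lemma Rpower_lipschitz (p L a b : R) :
  1 <= p -> 0 < a <= L -> 0 < b <= L ->
  (Rpower b p - Rpower a p) ^ 2
    <= p * Rpower L (p - 1) * ((b - a) * (Rpower b p - Rpower a p)).
Proof.
  intros Hp Ha Hb.
  destruct (MVT_pos (fun y => Rpower y p) (fun y => p * Rpower y (p - 1)) a b)
    as [c [Hc0 [Hc Heq]]]; try lra.
  { intros t Ht. now apply is_derive_Rpower. }
  cbv beta in Heq. rewrite Heq.
  assert (H1 : Rpower c (p - 1) <= Rpower L (p - 1)) by (apply Rle_Rpower_l; lra).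
  assert (H2 := Rpower_gt_0 c (p - 1)).
  set (k := Rpower c (p - 1)) in *.
  replace ((p * k * (b - a)) ^ 2) with (k * (p * p * k * (b - a) ^ 2)) by ring.
  replace (p * Rpower L (p - 1) * ((b - a) * (p * k * (b - a))))
    with (Rpower L (p - 1) * (p * p * k * (b - a) ^ 2)) by ring.
  apply Rmult_le_compat_r; [|exact H1].
  apply Rmult_le_pos; [|apply pow2_ge_0].
  apply Rmult_le_pos; nra.
Qed.

(** * The autonomous system and its energy *)

Record emden_fowler (p kappa theta : R) (x Z : R -> R) : Prop := {
  ef_pos : forall t, 0 < Z t;
  ef_x : forall t, is_derive x t (theta - Rpower (Z t) (/ p));
  ef_Z : forall t, is_derive Z t
           (kappa * Rpower theta p * exp (x t) - kappa * Z t) }.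

Definition energy (p kappa theta x Z : R) : R :=
  kappa * Rpower theta p * (exp x - 1 - x) + potential p theta Z.

(** The terms containing $e^x$ cancel, which is what the weight $\kappa\theta^p$ is for; only
    dissipation in [Z] is left. *)
Lemma is_derive_energy (p kappa theta : R) (x Z : R -> R) (t : R) :
  1 <= p -> emden_fowler p kappa theta x Z ->
  is_derive (fun t => energy p kappa theta (x t) (Z t)) t
    (- kappa * ((Rpower (Z t) (/ p) - theta) * (Z t - Rpower theta p))).
Proof.
  intros Hp [Hpos Hx HZ]. unfold energy.
  evar_last.
  - apply (is_derive_plus
      (fun t => kappa * Rpower theta p * (exp (x t) - 1 - x t))
      (fun t => potential p theta (Z t))).
    + apply (is_derive_comp (fun x => kappa * Rpower theta p * (exp x - 1 - x)) x);
        [|apply Hx].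
      auto_derive; [exact I | reflexivity].
    + apply (is_derive_comp (potential p theta) Z); [|apply HZ].
      now apply is_derive_potential.
  - unfold plus, scal; simpl; unfold mult; simpl. ring.
Qed.

(** The last summand equals $\kappa\theta^p x(e^x-1) - \kappa x(Z-\theta^p)$; its first term is the
    damping in [x] that the energy derivative lacks. *)
Lemma is_derive_cross_term (p kappa theta : R) (x Z : R -> R) (t : R) :
  emden_fowler p kappa theta x Z ->
  is_derive (fun t => x t * (Z t - Rpower theta p)) t
    ((theta - Rpower (Z t) (/ p)) * (Z t - Rpower theta p)
     + x t * (kappa * Rpower theta p * exp (x t) - kappa * Z t)).
Proof.
  intros [Hpos Hx HZ].
  assert (Dx := is_derive_unique _ _ _ (Hx t)).
  assert (DZ := is_derive_unique _ _ _ (HZ t)).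
  auto_derive.
  - repeat split; eexists; [apply Hx | apply HZ].
  - rewrite (Derive_ext (fun x0 => x x0) x), (Derive_ext (fun x0 => Z x0) Z), Dx, DZ by reflexivity. ring.
Qed.

Lemma energy_decreasing (p kappa theta : R) (x Z : R -> R) (s t : R) :
  1 <= p -> 0 < kappa -> 0 < theta -> emden_fowler p kappa theta x Z ->
  s <= t -> energy p kappa theta (x t) (Z t) <= energy p kappa theta (x s) (Z s).
Proof.
  intros Hp Hk Ht HS Hst.
  apply Rminus_le. rewrite <- (Rmult_0_l (t - s)).
  apply (increment_le (fun t => energy p kappa theta (x t) (Z t))
    (fun t => - kappa * ((Rpower (Z t) (/ p) - theta) * (Z t - Rpower theta p)))
    0 s t Hst).
  - intros r _. now apply is_derive_energy.
  - intros r _.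
    assert (H := potential_bounds p theta (Z r) Hp Ht (ef_pos _ _ _ _ _ HS r)).
    simpl. nra.
Qed.

(** Convexity in each variable: $e^x - 1 - x \le x(e^x-1)$ amounts to $e^x(1-x) \le 1$, and the
    other half is [potential_bounds]. *)
Lemma energy_le_dissipation (p kappa theta x Z : R) :
  1 <= p -> 0 < kappa -> 0 < theta -> 0 < Z ->
  energy p kappa theta x Z
    <= kappa * Rpower theta p * (x * (exp x - 1))
       + (Rpower Z (/ p) - theta) * (Z - Rpower theta p).
Proof.
  intros Hp Hk Ht HZ. unfold energy.
  assert (H := potential_bounds p theta Z Hp Ht HZ).
  apply Rplus_le_compat; [|apply H].
  apply Rmult_le_compat_l.
  { left. apply Rmult_lt_0_compat; [exact Hk | apply Rpower_gt_0]. }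
  assert (H1 := exp_ineq1_le (- x)).
  assert (H2 : exp x * exp (- x) = 1) by (rewrite <- exp_plus, Rplus_opp_r; apply exp_0).
  assert (H3 := exp_pos x). nra.
Qed.

(** Both summands of the energy are nonnegative, so each is at most [Rmax K 0]. The condition
    [theta < L] places the equilibrium inside the range where [Rpower_lipschitz] is applied. *)
Lemma energy_sublevel_bounded (p kappa theta K : R) :
  1 <= p -> 0 < kappa -> 0 < theta ->
  exists X L, 0 < X /\ theta < L /\
  forall x Z, 0 < Z -> energy p kappa theta x Z <= K ->
  Rabs x <= X /\ Rpower Z (/ p) <= L.
Proof.
  intros Hp Hk Ht.
  assert (Hzs : 0 < kappa * Rpower theta p)
    by (apply Rmult_lt_0_compat; [exact Hk | apply Rpower_gt_0]).
  set (zs := kappa * Rpower theta p) in *.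
  set (k := Rmax K 0 / zs).
  assert (Hm0 := Rmax_r K 0). assert (HmK := Rmax_l K 0).
  assert (Hk0 : 0 <= k) by (apply Rdiv_le_0_compat; lra).
  exists (1 + 4 * k), (1 + 2 * (theta + Rmax K 0)).
  split; [lra|]. split; [lra|].
  intros x Z HZ HE. unfold energy in HE. fold zs in HE.
  destruct (potential_bounds p theta Z Hp Ht HZ) as [Hg _].
  assert (He := exp_ineq1_le x).
  split.
  - assert (H1 : exp x - 1 - x <= k).
    { unfold k. apply Rmult_le_reg_l with zs; [exact Hzs|].
      replace (zs * (Rmax K 0 / zs)) with (Rmax K 0) by (field; lra). lra. }
    assert (Hep := exp_pos x).
    apply Rabs_le. split; [lra|].
    destruct (Rle_dec x 1) as [|Hx1]; [lra|].
    (* For $x > 1$, squaring gives $x^2/4 \le k$, hence $x \le x^2 \le 4k$. *)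
    assert (H2 := exp_ineq1_le (x / 2)).
    replace x with (x / 2 + x / 2) in H1 at 1 by field.
    rewrite exp_plus in H1. nra.
  - apply potential_coercive; try assumption.
    assert (0 <= zs * (exp x - 1 - x)) by (apply Rmult_le_pos; lra). lra.
Qed.

(** * Decay and convergence uniform over orbits *)

(** Integrating $F' \le -\frac{\epsilon}{2}E$ over $[t_0,t]$, with $E(s) \ge E(t)$ and the cross
    term bounded by [W], gives $\frac{\epsilon}{2}(t-t_0)E(t) \le |K| + 2\epsilon W$. *)
Lemma emden_fowler_uniform_decay (p kappa theta K : R) :
  1 <= p -> 0 < kappa -> 0 < theta ->
  exists C, 0 < C /\
  forall (x Z : R -> R) (t0 t : R), emden_fowler p kappa theta x Z ->
  energy p kappa theta (x t0) (Z t0) <= K -> t0 < t ->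
  energy p kappa theta (x t) (Z t) <= C / (t - t0).
Proof.
  intros Hp Hk Ht.
  destruct (energy_sublevel_bounded p kappa theta K Hp Hk Ht)
    as [X [L [HX [HL Hsub]]]].
  assert (HZs := Rpower_gt_0 theta p).
  assert (HLp := Rpower_gt_0 L p).
  set (C2 := p * Rpower L (p - 1)).
  assert (HC2 : 0 < C2) by (apply Rmult_lt_0_compat; [lra | apply Rpower_gt_0]).
  (* On the sublevel set, $a x^2 \le \kappa\theta^p x(e^x-1)$. *)
  set (a := kappa * Rpower theta p * exp (- X)).
  assert (Ha : 0 < a) by (repeat apply Rmult_lt_0_compat; auto using exp_pos).
  set (C3 := kappa ^ 2 / (2 * a) * C2).
  assert (HC3 : 0 < C3).
  { apply Rmult_lt_0_compat; [|exact HC2]. apply Rdiv_lt_0_compat; nra. }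
  (* Chosen so that [eps * (C3 + 1) = kappa / 2]: the cross term then costs at most half of the
     dissipation [kappa * P]. *)
  set (eps := kappa / (2 * (C3 + 1))).
  assert (Heps : 0 < eps) by (apply Rdiv_lt_0_compat; lra).
  assert (Heq : eps * C3 + eps = kappa / 2) by (unfold eps; field; lra).
  set (W := X * (Rpower L p + Rpower theta p)).
  assert (HW : 0 < W) by (apply Rmult_lt_0_compat; lra).
  exists ((Rabs K + 2 * eps * W) * (2 / eps)).
  assert (HK := Rabs_pos K).
  split.
  { apply Rmult_lt_0_compat; [|apply Rdiv_lt_0_compat; lra]. nra. }
  intros x Z t0 t HS HE Hlt.
  assert (Hpos := ef_pos _ _ _ _ _ HS).
  set (E := fun s => energy p kappa theta (x s) (Z s)).
  assert (HB : forall s, t0 <= s -> Rabs (x s) <= X /\ Rpower (Z s) (/ p) <= L).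
  { intros s Hs. apply Hsub; [apply Hpos|].
    apply Rle_trans with (2 := HE). now apply energy_decreasing. }
  assert (HZb : forall s, t0 <= s -> Z s <= Rpower L p).
  { intros s Hs. rewrite <- (Rpower_inv_r (Z s) p) by (try apply Hpos; lra).
    apply Rle_Rpower_l; [lra|]. split; [apply Rpower_gt_0 | now apply HB]. }
  assert (HWb : forall s, t0 <= s -> Rabs (x s * (Z s - Rpower theta p)) <= W).
  { intros s Hs. rewrite Rabs_mult.
    apply Rmult_le_compat; try apply Rabs_pos; [now apply HB|].
    specialize (HZb s Hs). specialize (Hpos s). apply Rabs_le; lra. }
  assert (HF := increment_le
    (fun s => E s - eps * (x s * (Z s - Rpower theta p)))
    (fun s => - kappa * ((Rpower (Z s) (/ p) - theta) * (Z s - Rpower theta p))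
       - eps * ((theta - Rpower (Z s) (/ p)) * (Z s - Rpower theta p)
        + x s * (kappa * Rpower theta p * exp (x s) - kappa * Z s)))
    (* The bound on the derivative is frozen at the right endpoint, where the energy is smallest. *)
    (- (eps / 2 * E t)) t0 t).
  assert (Hdec : E t - eps * (x t * (Z t - Rpower theta p)) -
     (E t0 - eps * (x t0 * (Z t0 - Rpower theta p))) <= - (eps / 2 * E t) * (t - t0)).
  { apply HF; clear HF; [lra| |].
    - intros s Hs.
      apply (is_derive_minus E (fun s => eps * (x s * (Z s - Rpower theta p)))).
      + now apply is_derive_energy.
      + apply (is_derive_scal (fun s => x s * (Z s - Rpower theta p))).
        now apply is_derive_cross_term.
    - intros s Hs. cbv beta.
      assert (HEs : E t <= E s) by (apply energy_decreasing; auto; lra).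
      assert (HD := energy_le_dissipation p kappa theta (x s) (Z s) Hp Hk Ht (Hpos s)).
      fold (E s) in HD.
      destruct (HB s) as [Hx Hm]; [lra|].
      assert (Hlip := Rpower_lipschitz p L theta (Rpower (Z s) (/ p)) Hp
        ltac:(lra) (conj (Rpower_gt_0 _ _) Hm)).
      rewrite Rpower_inv_r in Hlip by (try apply Hpos; lra).
      fold C2 in Hlip.
      assert (HP := potential_bounds p theta (Z s) Hp Ht (Hpos s)).
      apply Rabs_le_between in Hx.
      assert (HQ := exp_minus_1_lower (x s) X ltac:(lra) ltac:(lra)).
      apply (Rmult_le_compat_l (kappa * Rpower theta p)) in HQ; [|nra].
      rewrite <- Rmult_assoc in HQ. fold a in HQ.
      set (P := (Rpower (Z s) (/ p) - theta) * (Z s - Rpower theta p)) in *.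
      set (Q := kappa * Rpower theta p * (x s * (exp (x s) - 1))) in *.
      set (y := Z s - Rpower theta p) in *.
      (* Young: [kappa x y <= a x^2 / 2 + kappa^2 y^2 / (2 a)] *)
      assert (HY : kappa * (x s * y) <= Q / 2 + C3 * P).
      { assert (kappa * (x s * y) <= a * x s ^ 2 / 2 + kappa ^ 2 / (2 * a) * y ^ 2).
        { apply Rminus_le.
          replace (kappa * (x s * y) - (a * x s ^ 2 / 2 + kappa ^ 2 / (2 * a) * y ^ 2))
            with (- ((a * x s - kappa * y) ^ 2 / (2 * a))) by (field; lra).
          assert (0 <= (a * x s - kappa * y) ^ 2 / (2 * a)).
          { apply Rdiv_le_0_compat; [apply pow2_ge_0 | lra]. }
          lra. }
        assert (kappa ^ 2 / (2 * a) * y ^ 2 <= C3 * P).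
        { unfold C3. rewrite Rmult_assoc. apply Rmult_le_compat_l; [|exact Hlip].
          apply Rdiv_le_0_compat; nra. }
        lra. }
      replace (- kappa * P - eps * ((theta - Rpower (Z s) (/ p)) * y +
         x s * (kappa * Rpower theta p * exp (x s) - kappa * Z s)))
        with (- kappa * P + eps * P - eps * Q + eps * (kappa * (x s * y)))
        by (unfold P, Q, y; ring).
      apply (Rmult_le_compat_l eps) in HY; [|lra].
      assert (HEP : eps / 2 * E t <= eps / 2 * (Q + P)) by (apply Rmult_le_compat_l; lra).
      (* The derivative is at most [- (kappa / 2) * P - (eps / 2) * Q]; with [eps <= kappa] this is
         at most [- (eps / 2) * (P + Q)]. *)
      assert (HeP : eps * P <= kappa * P).
      { apply Rmult_le_compat_r; [lra|]. nra. }
      replace (eps * (Q / 2 + C3 * P)) with (eps / 2 * Q + (eps * C3 + eps) * P - eps * P) in HY by field.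
      rewrite Heq in HY. lra. }
  assert (H1 := HWb t ltac:(lra)). assert (H2 := HWb t0 ltac:(lra)).
  apply Rabs_le_between in H1. apply Rabs_le_between in H2.
  assert (HKa := Rle_abs K).
  fold (E t0) in HE. fold (E t).
  assert (HEt : 0 <= E t).
  { unfold E, energy.
    destruct (potential_bounds p theta (Z t) Hp Ht (Hpos t)) as [Hg _].
    assert (He := exp_ineq1_le (x t)).
    apply Rplus_le_le_0_compat; [|exact Hg].
    apply Rmult_le_pos; [apply Rmult_le_pos|]; lra. }
  apply Rmult_le_reg_r with (t - t0); [lra|].
  replace ((Rabs K + 2 * eps * W) * (2 / eps) / (t - t0) * (t - t0))
    with ((Rabs K + 2 * eps * W) * (2 / eps)) by (field; lra).
  apply Rmult_le_reg_r with (eps / 2); [lra|].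
  replace ((Rabs K + 2 * eps * W) * (2 / eps) * (eps / 2))
    with (Rabs K + 2 * eps * W) by (field; lra).
  assert (eps * (x t * (Z t - Rpower theta p)) <= eps * W)
    by (apply Rmult_le_compat_l; lra).
  assert (- (eps * W) <= eps * (x t0 * (Z t0 - Rpower theta p)))
    by (rewrite Ropp_mult_distr_r; apply Rmult_le_compat_l; lra).
  lra.
Qed.

Lemma emden_fowler_uniform_convergence (p kappa theta B eps : R) :
  1 <= p -> 0 < kappa -> 0 < theta -> 0 < eps ->
  exists T,
  forall (x Z : R -> R) (t0 t : R), emden_fowler p kappa theta x Z ->
  Rabs (x t0) <= B -> Z t0 <= B -> t0 + T <= t -> Rabs (x t) < eps.
Proof.
  intros Hp Hk Ht Heps.
  assert (HZs := Rpower_gt_0 theta p).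
  assert (Hzs : 0 < kappa * Rpower theta p) by now apply Rmult_lt_0_compat.
  (* This energy level bounds the right side of [energy_le_dissipation] when $|x| \le B$ and $Z \le
     B$. *)
  destruct (emden_fowler_uniform_decay p kappa theta
     (kappa * Rpower theta p * (B * (exp B + 1))
      + (Rpower B (/ p) * B + theta * Rpower theta p)) Hp Hk Ht) as [C [HC Hdec]].
  (* If $|x| \ge \epsilon$ then $e^x - 1 - x \ge d$, so the energy is at least $\kappa\theta^p d$;
     the delay below makes the decay bound strictly smaller, the added 1 giving strictness. *)
  set (d := Rmin (eps ^ 2 / 4) 1).
  assert (Hd : 0 < d) by (apply Rmin_glb_lt; nra).
  assert (Hzd : 0 < kappa * Rpower theta p * d) by now apply Rmult_lt_0_compat.
  assert (HT : 0 < C / (kappa * Rpower theta p * d)) by now apply Rdiv_lt_0_compat.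
  exists (C / (kappa * Rpower theta p * d) + 1).
  intros x Z t0 t HS HxB HZB Htt.
  assert (Hpos := ef_pos _ _ _ _ _ HS).
  assert (HE : energy p kappa theta (x t) (Z t) <= C / (t - t0)).
  { apply Hdec; [exact HS| |lra].
    eapply Rle_trans; [apply energy_le_dissipation; auto|].
    assert (HZ0 := Hpos t0).
    assert (Hm : Rpower (Z t0) (/ p) <= Rpower B (/ p)).
    { apply Rle_Rpower_l; [left; apply Rinv_0_lt_compat; lra | lra]. }
    assert (Hm0 := Rpower_gt_0 (Z t0) (/ p)).
    apply Rplus_le_compat.
    - apply Rmult_le_compat_l; [lra|].
      apply Rle_trans with (1 := Rle_abs _). rewrite Rabs_mult.
      apply Rmult_le_compat; try apply Rabs_pos; [exact HxB|].
      assert (He : exp (x t0) <= exp B).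
      { apply Rabs_le_between in HxB.
        destruct (Req_dec (x t0) B) as [->|Hne]; [lra|].
        left. apply exp_increasing; lra. }
      assert (He0 := exp_pos (x t0)). apply Rabs_le; lra.
    - assert (Rpower (Z t0) (/ p) * Z t0 <= Rpower B (/ p) * B)
        by (apply Rmult_le_compat; lra).
      assert (0 <= Rpower (Z t0) (/ p) * Rpower theta p) by nra.
      assert (0 <= theta * Z t0) by nra.
      nra. }
  apply Rnot_le_lt. intros Hge.
  assert (Hx2 : eps ^ 2 <= x t ^ 2).
  { rewrite <- (pow2_abs (x t)). apply pow_incr; lra. }
  assert (Hdx : d <= exp (x t) - 1 - x t).
  { apply Rle_trans with (2 := exp_ineq_quad (x t)).
    apply Rle_min_compat_r. lra. }
  assert (Hlow : kappa * Rpower theta p * d <= C / (t - t0)).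
  { apply Rle_trans with (2 := HE). unfold energy.
    destruct (potential_bounds p theta (Z t) Hp Ht (Hpos t)) as [Hg _].
    assert (kappa * Rpower theta p * d <= kappa * Rpower theta p * (exp (x t) - 1 - x t))
      by (apply Rmult_le_compat_l; lra).
    lra. }
  apply (Rmult_le_compat_r (t - t0)) in Hlow; [|lra].
  replace (C / (t - t0) * (t - t0)) with C in Hlow by (field; lra).
  assert (Hc : kappa * Rpower theta p * d * (C / (kappa * Rpower theta p * d) + 1)
      <= kappa * Rpower theta p * d * (t - t0)) by (apply Rmult_le_compat_l; lra).
  rewrite Rmult_plus_distr_l in Hc.
  replace (kappa * Rpower theta p * d * (C / (kappa * Rpower theta p * d)))
    with C in Hc by (field; lra).
  lra.
Qed.

(** * Regular solutions: the flux and the behaviour at the origin *)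

Lemma phi_opp (beta v : R) : phi beta (- v) = - phi beta v.
Proof.
  unfold phi. rewrite Rabs_Ropp.
  destruct (Req_EM_T (- v) 0), (Req_EM_T v 0); try lra.
Qed.

Lemma phi_pos (beta v : R) : 0 < v -> phi beta v = Rpower v (beta + 1).
Proof.
  intros Hv. unfold phi. destruct (Req_EM_T v 0); [lra|].
  now rewrite Rabs_pos_eq, Rpower_plus, (Rpower_1 v) by lra.
Qed.

Lemma phi_pos_inv (beta v : R) : 0 < phi beta v -> 0 < v.
Proof.
  unfold phi. destruct (Req_EM_T v 0); [lra|].
  assert (H := Rpower_gt_0 (Rabs v) beta). nra.
Qed.

Lemma log_growth_unbounded (f df : R -> R) (c l d : R) :
  0 < c -> 0 < d ->
  (forall r, 0 < r <= d -> is_derive f r (df r)) ->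
  (forall r, 0 < r <= d -> c / r <= df r) ->
  ~ (forall r, 0 < r <= d -> Rabs (f r - l) <= 1).
Proof.
  intros Hc Hd Hf Hdf Hl.
  (* From [e] to [d] the function $c \ln r$ grows by 3, whereas values within 1 of [l] differ by at
     most 2. *)
  set (e := d * exp (- (3 / c))).
  assert (H3 : 0 < 3 / c) by (apply Rdiv_lt_0_compat; lra).
  assert (He : 0 < e) by (apply Rmult_lt_0_compat; [exact Hd | apply exp_pos]).
  assert (Hed : e <= d).
  { unfold e. rewrite <- (Rmult_1_r d) at 2. apply Rmult_le_compat_l; [lra|].
    rewrite <- exp_0. left. apply exp_increasing. lra. }
  assert (H := increment_le (fun r => c * ln r - f r) (fun r => c * / r - df r) 0 e d Hed).
  cbv beta in H.
  assert (Hln : ln e = ln d - 3 / c).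
  { unfold e. rewrite ln_mult, ln_exp by (try apply exp_pos; lra). ring. }
  assert (H1 : c * ln d - f d - (c * ln e - f e) <= 0 * (d - e)).
  { apply H.
    - intros t Ht. apply (is_derive_minus (fun r => c * ln r) f); [|apply Hf; lra].
      apply (is_derive_scal ln). apply is_derive_Reals, derivable_pt_lim_ln. lra.
    - intros t Ht. specialize (Hdf t). unfold Rdiv in Hdf. lra. }
  rewrite Hln in H1.
  replace (c * (ln d - 3 / c)) with (c * ln d - 3) in H1 by (field; lra).
  assert (Ha := Hl e ltac:(lra)). assert (Hb := Hl d ltac:(lra)).
  apply Rabs_le_between in Ha. apply Rabs_le_between in Hb. lra.
Qed.

(* A nonzero flux at the origin would force [f' >= c / r], because
   [alpha / (beta + 1) >= 1]. *)
Lemma flux_not_bounded_below (alpha beta c l d : R) (f df : R -> R) :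
  0 <= beta -> beta + 1 <= alpha -> 0 < c -> 0 < d ->
  (forall r, 0 < r <= d -> is_derive f r (df r)) ->
  (forall r, 0 < r <= d -> c <= Rpower r alpha * phi beta (df r)) ->
  ~ (forall r, 0 < r <= d -> Rabs (f r - l) <= 1).
Proof.
  intros Hb Hab Hc Hd Hf Hflux Hl.
  assert (Hmin : 0 < Rmin d 1) by (apply Rmin_glb_lt; lra).
  assert (Hmd := Rmin_l d 1). assert (Hm1 := Rmin_r d 1).
  apply (log_growth_unbounded f df (Rpower c (/ (beta + 1))) l (Rmin d 1));
    [apply Rpower_gt_0 | exact Hmin | | | ].
  - intros r Hr. apply Hf; lra.
  - intros r Hr.
    assert (Hra := Rpower_gt_0 r alpha).
    assert (H := Hflux r ltac:(lra)).
    assert (Hv : 0 < df r).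
    { apply (phi_pos_inv beta). nra. }
    rewrite phi_pos in H by exact Hv.
    assert (Hc2 : c <= Rpower (r * df r) (beta + 1)).
    { apply Rle_trans with (1 := H).
      rewrite <- Rpower_mult_distr by lra.
      apply Rmult_le_compat_r; [left; apply Rpower_gt_0|].
      unfold Rpower.
      assert (Hln : ln r <= 0).
      { rewrite <- ln_1. destruct (Req_dec r 1) as [->|]; [lra|].
        left. apply ln_increasing; lra. }
      destruct (Rle_lt_or_eq_dec (alpha * ln r) ((beta + 1) * ln r)) as [Hlt|Heq];
        [nra | left; now apply exp_increasing | rewrite Heq; lra]. }
    apply Rmult_le_reg_l with r; [lra|].
    replace (r * (Rpower c (/ (beta + 1)) / r)) with (Rpower c (/ (beta + 1))) by (field; lra).
    rewrite <- (Rpower_inv_l (r * df r) (beta + 1)) by nra.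
    apply Rle_Rpower_l; [left; apply Rinv_0_lt_compat; lra | lra].
  - intros r Hr. apply Hl; lra.
Qed.

Definition flux (alpha beta : R) (u : R -> R) (r : R) : R :=
  Rpower r alpha * phi beta (Derive u r).

(** The zero right derivative at the origin makes the difference quotient eventually smaller than 1;
    this is the form in which the initial conditions are used. *)
Lemma sol_near_zero (alpha beta gamma rho : R) (u : R -> R) :
  is_sol_ivp alpha beta gamma rho u ->
  exists d, 0 < d /\ forall r, 0 < r < d -> Rabs (u r - rho) < r.
Proof.
  intros [H0 [Hlim _]].
  destruct (Hlim _ (locally_ball 0 (mkposreal 1 Rlt_0_1))) as [d Hd].
  exists d. split; [apply cond_pos|]. intros r Hr.
  assert (H : Rabs ((u r - u 0) / r - 0) < 1).
  { apply (Hd r); [|apply Hr].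
    change (Rabs (r - 0) < d). rewrite Rminus_0_r, Rabs_pos_eq; lra. }
  rewrite Rminus_0_r, H0 in H. unfold Rdiv in H.
  rewrite Rabs_mult, (Rabs_pos_eq (/ r)) in H
    by (left; apply Rinv_0_lt_compat; lra).
  apply (Rmult_lt_compat_r r) in H; [|lra].
  rewrite Rmult_assoc, Rinv_l, Rmult_1_r, Rmult_1_l in H by lra. exact H.
Qed.

Lemma sol_close_on_interval (alpha beta gamma rho r1 : R) (u : R -> R) :
  is_sol_ivp alpha beta gamma rho u -> 0 < r1 ->
  exists d, 0 < d <= r1 /\ forall r, 0 < r <= d -> Rabs (u r - rho) <= 1.
Proof.
  intros Hs Hr1. destruct (sol_near_zero _ _ _ _ _ Hs) as [d [Hd H]].
  set (e := Rmin (d / 2) (Rmin 1 r1)).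
  assert (He : 0 < e) by (repeat apply Rmin_glb_lt; lra).
  assert (e <= d / 2) by apply Rmin_l.
  assert (Hm : e <= Rmin 1 r1) by apply Rmin_r.
  assert (H1 := Rmin_l 1 r1). assert (H2 := Rmin_r 1 r1).
  exists e. split; [lra|]. intros r Hr. specialize (H r). lra.
Qed.

(** The flux is strictly decreasing. Were it nonnegative at [r], it would exceed a positive constant
    on [(0, r/2]], which [flux_not_bounded_below] excludes as [u] is bounded near 0. No limit of the
    flux at 0 is assumed. *)
Lemma sol_flux_neg (alpha beta gamma rho r : R) (u : R -> R) :
  0 <= beta -> beta + 1 <= alpha -> is_sol_ivp alpha beta gamma rho u ->
  0 < r -> flux alpha beta u r < 0.
Proof.
  intros Hb Hab Hs Hr. apply Rnot_le_lt. intros Hpos.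
  assert (Hs' := Hs). destruct Hs' as [_ [_ [Hex Hfl]]].
  assert (Hinc : forall s t, 0 < s -> s < t -> flux alpha beta u t < flux alpha beta u s).
  { intros s t H1 H2.
    destruct (MVT_pos (flux alpha beta u)
      (fun s => - (Rpower s gamma * exp (u s))) s t) as [c [Hc0 [_ Heq]]];
      [lra | lra | exact Hfl |].
    assert (0 < Rpower c gamma * exp (u c))
      by (apply Rmult_lt_0_compat; apply exp_pos).
    nra. }
  assert (Hc := Hinc (r / 2) r ltac:(lra) ltac:(lra)).
  destruct (sol_close_on_interval _ _ _ _ (r / 2) _ Hs ltac:(lra)) as [d [Hd Hl]].
  apply (flux_not_bounded_below alpha beta (flux alpha beta u (r / 2)) rho d u (Derive u));
    try lra; try assumption.
  - intros t Ht. apply Derive_correct, Hex. lra.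
  - intros t Ht. change (flux alpha beta u (r / 2) <= flux alpha beta u t).
    destruct (Req_dec t (r / 2)) as [->|]; [lra|]. left. apply Hinc; lra.
Qed.

Lemma sol_slope (alpha beta gamma rho r : R) (u : R -> R) :
  0 <= beta -> beta + 1 <= alpha -> is_sol_ivp alpha beta gamma rho u ->
  0 < r ->
  Derive u r < 0 /\
  - flux alpha beta u r = Rpower r alpha * Rpower (- Derive u r) (beta + 1).
Proof.
  intros Hb Hab Hs Hr.
  assert (H := sol_flux_neg _ _ _ _ _ _ Hb Hab Hs Hr).
  assert (H1 := Rpower_gt_0 r alpha).
  assert (Hv : 0 < - Derive u r).
  { apply (phi_pos_inv beta). rewrite phi_opp. unfold flux in H. nra. }
  split; [lra|].
  rewrite <- phi_pos, phi_opp by exact Hv. unfold flux. ring.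
Qed.

(** * A priori bounds on regular solutions *)

Lemma sol_decreasing (alpha beta gamma rho r s : R) (u : R -> R) :
  0 <= beta -> beta + 1 <= alpha -> is_sol_ivp alpha beta gamma rho u ->
  0 < r -> r <= s -> u s <= u r.
Proof.
  intros Hb Hab Hs Hr Hrs.
  apply Rminus_le. rewrite <- (Rmult_0_l (s - r)).
  apply (increment_le u (Derive u)); [exact Hrs| |].
  - intros t Ht. destruct Hs as [_ [_ [Hex _]]]. apply Derive_correct, Hex. lra.
  - intros t Ht. left. apply (sol_slope alpha beta gamma rho); auto; lra.
Qed.

Lemma sol_le_initial (alpha beta gamma rho r : R) (u : R -> R) :
  0 <= beta -> beta + 1 <= alpha -> is_sol_ivp alpha beta gamma rho u ->
  0 < r -> u r <= rho.
Proof.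
  intros Hb Hab Hs Hr. apply Rnot_lt_le. intros Hlt.
  destruct (sol_near_zero _ _ _ _ _ Hs) as [d [Hd H]].
  (* Monotonicity gives $u(h) \ge u(r) \ge \rho + h$, against $|u(h)-\rho| < h$. *)
  set (h := Rmin (d / 2) (Rmin r (u r - rho))).
  assert (Hh : 0 < h) by (repeat apply Rmin_glb_lt; lra).
  assert (H1 : h <= d / 2) by apply Rmin_l.
  assert (H2 : h <= r) by (eapply Rle_trans; [apply Rmin_r | apply Rmin_l]).
  assert (H3 : h <= u r - rho) by (eapply Rle_trans; [apply Rmin_r | apply Rmin_r]).
  specialize (H h ltac:(lra)). apply Rabs_lt_between in H.
  assert (H4 := sol_decreasing _ _ _ _ _ _ _ Hb Hab Hs Hh H2). lra.
Qed.

(** Integration of $r^\gamma e^u \le r^\gamma e^\rho$ from 0. The boundary term is handled by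
    contradiction: the nonincreasing [h], if positive at [r], would keep the flux of [- u] above
    [h r] on [(0, r]]. *)
Lemma sol_flux_bound (alpha beta gamma rho r : R) (u : R -> R) :
  0 <= beta -> beta + 1 <= alpha -> 0 < gamma + 1 ->
  is_sol_ivp alpha beta gamma rho u -> 0 < r ->
  - flux alpha beta u r <= exp rho / (gamma + 1) * Rpower r (gamma + 1).
Proof.
  intros Hb Hab Hg Hs Hr.
  set (h := fun s => - flux alpha beta u s - exp rho / (gamma + 1) * Rpower s (gamma + 1)).
  apply Rnot_lt_le. intros Hlt.
  assert (Hh0 : 0 < h r) by (unfold h; lra).
  assert (Hdec : forall s, 0 < s <= r -> h r <= h s).
  { intros s Hsr. apply Rminus_le. rewrite <- (Rmult_0_l (r - s)).
    apply (increment_le h (fun t => Rpower t gamma * (exp (u t) - exp rho))); [lra| |].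
    - intros t Ht. unfold h. evar_last.
      + apply (is_derive_minus (fun t => - flux alpha beta u t)
          (fun s => exp rho / (gamma + 1) * Rpower s (gamma + 1))).
        * apply (is_derive_opp (flux alpha beta u)).
          destruct Hs as [_ [_ [_ Hfl]]]. apply Hfl. lra.
        * apply (is_derive_scal (fun s => Rpower s (gamma + 1))).
          apply is_derive_Rpower. lra.
      + unfold minus, plus, opp; simpl.
        replace (gamma + 1 - 1) with gamma by ring. field. lra.
    - intros t Ht.
      assert (Hu := sol_le_initial alpha beta gamma rho t u Hb Hab Hs ltac:(lra)).
      assert (exp (u t) <= exp rho).
      { destruct (Req_dec (u t) rho) as [->|]; [lra|]. left. apply exp_increasing. lra. }
      assert (Hp := Rpower_gt_0 t gamma). nra. }
  destruct (sol_close_on_interval _ _ _ _ r _ Hs Hr) as [d [Hd Hl]].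
  apply (flux_not_bounded_below alpha beta (h r) (- rho) d
    (fun t => - u t) (fun t => - Derive u t)); try lra; try assumption.
  - intros t Ht. apply (is_derive_opp u), Derive_correct.
    destruct Hs as [_ [_ [Hex _]]]. apply Hex. lra.
  - intros t Ht. rewrite phi_opp.
    assert (H := Hdec t ltac:(lra)). unfold h at 2 in H. unfold flux in H.
    assert (0 < exp rho / (gamma + 1) * Rpower t (gamma + 1)).
    { apply Rmult_lt_0_compat; [|apply Rpower_gt_0].
      apply Rdiv_lt_0_compat; [apply exp_pos | exact Hg]. }
    lra.
  - intros t Ht. replace (- u t - - rho) with (- (u t - rho)) by ring.
    rewrite Rabs_Ropp. now apply Hl.
Qed.

(** The root of order $\beta+1$ of [sol_flux_bound] gives $-u' \le A t^{\theta/(\beta+1)-1}$, which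
    is integrated from 0. *)
Lemma sol_lower_bound (alpha beta gamma rho r : R) (u : R -> R) :
  0 <= beta -> beta + 1 < alpha -> 0 < gamma + 2 + beta - alpha ->
  is_sol_ivp alpha beta gamma rho u -> 0 < r ->
  let theta := gamma + 2 + beta - alpha in
  rho - (beta + 1) / theta * Rpower (exp rho / (gamma + 1)) (/ (beta + 1))
        * Rpower r (theta / (beta + 1)) <= u r.
Proof.
  intros Hb Hab Ht Hs Hr theta.
  assert (Hg : 0 < gamma + 1) by lra.
  change (0 < theta) in Ht.
  set (A := Rpower (exp rho / (gamma + 1)) (/ (beta + 1))).
  assert (HA : 0 < A) by apply Rpower_gt_0.
  assert (HE : 0 < exp rho / (gamma + 1)) by (apply Rdiv_lt_0_compat; [apply exp_pos | lra]).
  set (a := theta / (beta + 1)).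
  set (h := fun s => - (u s) - (beta + 1) / theta * A * Rpower s a).
  assert (Hdec : forall s, 0 < s <= r -> h r <= h s).
  { intros s Hsr. apply Rminus_le. rewrite <- (Rmult_0_l (r - s)).
    apply (increment_le h (fun t => - Derive u t - A * Rpower t (a - 1))); [lra| |].
    - intros t Htt. unfold h. evar_last.
      + apply (is_derive_minus (fun t => - u t)
          (fun s => (beta + 1) / theta * A * Rpower s a)).
        * apply (is_derive_opp u), Derive_correct.
          destruct Hs as [_ [_ [Hex _]]]. apply Hex. lra.
        * apply (is_derive_scal (fun s => Rpower s a)).
          apply is_derive_Rpower. lra.
      + unfold minus, plus, opp, a; simpl. field. lra.
    - intros t Htt.
      destruct (sol_slope alpha beta gamma rho t u) as [Hneg Hfl]; try lra; try assumption.
      assert (Hbd := sol_flux_bound alpha beta gamma rho t u Hb ltac:(lra) Hg Hs ltac:(lra)).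
      rewrite Hfl in Hbd.
      assert (Hm : Rpower (- Derive u t) (beta + 1)
         <= exp rho / (gamma + 1) * Rpower t (gamma + 1 - alpha)).
      { apply Rmult_le_reg_l with (Rpower t alpha); [apply Rpower_gt_0|].
        apply Rle_trans with (1 := Hbd). right.
        replace (gamma + 1) with (alpha + (gamma + 1 - alpha)) at 2 by ring.
        rewrite Rpower_plus. ring. }
      apply Rle_minus.
      rewrite <- (Rpower_inv_l (- Derive u t) (beta + 1)) by lra.
      replace (a - 1) with ((gamma + 1 - alpha) * / (beta + 1))
        by (unfold a, theta; field; lra).
      unfold A. rewrite <- Rpower_mult, Rpower_mult_distr by (auto using Rpower_gt_0).
      apply Rle_Rpower_l; [left; apply Rinv_0_lt_compat; lra|].
      split; [apply Rpower_gt_0 | exact Hm]. }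
  apply Rnot_lt_le. intros Hlt.
  destruct (sol_near_zero _ _ _ _ _ Hs) as [d [Hd H]].
  set (g := rho - (beta + 1) / theta * A * Rpower r a - u r).
  assert (Hg0 : 0 < g) by (unfold g; lra).
  set (s := Rmin (d / 2) (Rmin r g)).
  assert (Hs0 : 0 < s) by (repeat apply Rmin_glb_lt; lra).
  assert (H1 : s <= d / 2) by apply Rmin_l.
  assert (H2 : s <= r) by (eapply Rle_trans; [apply Rmin_r | apply Rmin_l]).
  assert (H3 : s <= g) by (eapply Rle_trans; [apply Rmin_r | apply Rmin_r]).
  specialize (H s ltac:(lra)). apply Rabs_lt_between in H.
  specialize (Hdec s ltac:(lra)). unfold h in Hdec. unfold g in H3.
  assert (0 < (beta + 1) / theta * A * Rpower s a).
  { repeat apply Rmult_lt_0_compat; try apply Rpower_gt_0; try lra.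
    apply Rinv_0_lt_compat; lra. }
  lra.
Qed.

(** * Passage to the Emden-Fowler variables *)

Lemma Rpower_exp (t a : R) : Rpower (exp t) a = exp (a * t).
Proof. unfold Rpower. now rewrite ln_exp. Qed.

(* Emden-Fowler variables: [t = ln r], [x = u - u*] and
   [Z = (- r u'(r)) ^ (beta + 1)]. *)
Lemma sol_emden_fowler (alpha beta gamma rho : R) (u : R -> R) :
  0 <= beta -> beta + 1 < alpha -> 0 < gamma + 2 + beta - alpha ->
  is_sol_ivp alpha beta gamma rho u ->
  let theta := gamma + 2 + beta - alpha in
  let kappa := alpha - beta - 1 in
  emden_fowler (beta + 1) kappa theta
    (fun t => u (exp t) + theta * t - ln (kappa * Rpower theta (beta + 1)))
    (fun t => exp (- kappa * t) * (- flux alpha beta u (exp t))).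
Proof.
  intros Hb Hab Ht Hs theta kappa.
  change (0 < theta) in Ht.
  assert (Hk : 0 < kappa) by (unfold kappa; lra).
  assert (Hzs : 0 < kappa * Rpower theta (beta + 1))
    by (apply Rmult_lt_0_compat; [exact Hk | apply Rpower_gt_0]).
  assert (Hsl : forall t, Derive u (exp t) < 0 /\
     - flux alpha beta u (exp t)
       = Rpower (exp t) alpha * Rpower (- Derive u (exp t)) (beta + 1)).
  { intros t. apply (sol_slope alpha beta gamma rho); auto using exp_pos; lra. }
  (* [Z] is written through the flux, whose derivative the equation supplies; the power form serves
     positivity and the equation for [x]. *)
  assert (HZ : forall t, exp (- kappa * t) * (- flux alpha beta u (exp t))
     = Rpower (exp t * - Derive u (exp t)) (beta + 1)).
  { intros t. destruct (Hsl t) as [Hneg ->].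
    rewrite <- Rpower_mult_distr, !Rpower_exp by (try apply exp_pos; lra).
    rewrite <- Rmult_assoc, <- exp_plus. f_equal. f_equal. unfold kappa. ring. }
  destruct Hs as [_ [_ [Hex Hfl]]].
  split.
  - intros t. rewrite HZ. apply Rpower_gt_0.
  - intros t. rewrite HZ.
    destruct (Hsl t) as [Hneg _]. assert (He := exp_pos t).
    rewrite Rpower_inv_l by nra.
    evar_last.
    + apply (is_derive_minus (fun t => u (exp t) + theta * t)
        (fun _ => ln (kappa * Rpower theta (beta + 1)))); [|apply is_derive_const].
      apply (is_derive_plus (fun t => u (exp t)) (fun t => theta * t)).
      * apply (is_derive_comp u exp); [apply Derive_correct, Hex, He|].
        apply is_derive_Reals, derivable_pt_lim_exp.
      * apply (is_derive_scal (fun t => t)), is_derive_id.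
    + unfold minus, plus, opp, scal, zero, one; simpl; unfold mult; simpl. ring.
  - intros t. assert (He := exp_pos t).
    evar_last.
    + apply (is_derive_mult (fun t => exp (- kappa * t))
        (fun t => - flux alpha beta u (exp t))).
      * auto_derive; [exact I | reflexivity].
      * apply (is_derive_opp (fun t => flux alpha beta u (exp t))).
        apply (is_derive_comp (flux alpha beta u) exp); [apply Hfl, He|].
        apply is_derive_Reals, derivable_pt_lim_exp.
      * intros; apply Rmult_comm.
    + unfold plus, opp, scal, mult; simpl; unfold mult; simpl.
      unfold Rminus at 2. rewrite !exp_plus, exp_Ropp, exp_ln, Rpower_exp by exact Hzs.
      replace (exp (theta * t)) with (exp (- kappa * t) * exp (gamma * t) * exp t).
      2: { rewrite <- !exp_plus. f_equal. unfold theta, kappa. ring. }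
      replace (-(1) * kappa * t) with (- kappa * t) by ring.
      field. split; [apply Rgt_not_eq, Rpower_gt_0 | lra].
Qed.

Lemma sol_uniform_convergence (alpha beta gamma eps : R) :
  0 <= beta -> beta + 1 < alpha -> 0 < gamma + 2 + beta - alpha -> 0 < eps ->
  let theta := gamma + 2 + beta - alpha in
  let kappa := alpha - beta - 1 in
  exists T, forall rho u r,
    is_sol_ivp alpha beta gamma rho u -> 0 < r -> T - rho / theta <= ln r ->
    Rabs (u r - (ln (kappa * Rpower theta (beta + 1)) - theta * ln r)) < eps.
Proof.
  intros Hb Hab Ht Heps theta kappa. change (0 < theta) in Ht.
  assert (Hg : 0 < gamma + 1) by (unfold theta in Ht; lra).
  set (lz := ln (kappa * Rpower theta (beta + 1))).
  (* The loss term of [sol_lower_bound] at $r = e^{-\rho/\theta}$, where the factors containing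
     $\rho$ cancel. *)
  set (K := (beta + 1) / theta * Rpower (/ (gamma + 1)) (/ (beta + 1))).
  assert (HK : 0 < K).
  { apply Rmult_lt_0_compat; [apply Rdiv_lt_0_compat; lra | apply Rpower_gt_0]. }
  assert (Hig : 0 < / (gamma + 1)) by now apply Rinv_0_lt_compat.
  assert (Hlz := Rabs_pos lz).
  destruct (emden_fowler_uniform_convergence (beta + 1) kappa theta
    (K + Rabs lz + / (gamma + 1)) eps) as [T HT]; try (unfold kappa; lra).
  exists T. intros rho u r Hs Hr Hlr.
  assert (Hr0 := exp_pos (- rho / theta)).
  assert (HEF := sol_emden_fowler _ _ _ _ _ Hb Hab Ht Hs).
  cbv zeta in HEF. fold theta kappa in HEF. fold lz in HEF.
  specialize (HT _ _ (- rho / theta) (ln r) HEF). cbv beta in HT.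
  rewrite exp_ln in HT by exact Hr.
  replace (u r - (lz - theta * ln r)) with (u r + theta * ln r - lz) by ring.
  apply HT; [| |unfold Rdiv in *; lra].
  - assert (Hup := sol_le_initial alpha beta gamma rho _ u Hb ltac:(lra) Hs Hr0).
    assert (Hlo := sol_lower_bound alpha beta gamma rho _ u Hb Hab Ht Hs Hr0).
    cbv zeta in Hlo. fold theta in Hlo.
    unfold Rdiv at 2 in Hlo.
    rewrite <- Rpower_mult_distr, !Rpower_exp in Hlo by (auto using exp_pos).
    rewrite <- (Rmult_assoc _ (exp _)), (Rmult_comm _ (exp (_ * rho))) in Hlo.
    replace (exp (/ (beta + 1) * rho) * ((beta + 1) / theta) * Rpower (/ (gamma + 1)) (/ (beta + 1)) * exp (theta / (beta + 1) * (- rho / theta)))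
      with K in Hlo.
    2: { replace (theta / (beta + 1) * (- rho / theta)) with (- (/ (beta + 1) * rho)) by (field; lra).
         rewrite exp_Ropp. unfold K. field.
         repeat split; try lra. apply Rgt_not_eq, exp_pos. }
    replace (theta * (- rho / theta)) with (- rho) by (field; lra).
    assert (Hl1 := Rle_abs lz). assert (Hl2 := Rle_abs (- lz)).
    rewrite Rabs_Ropp in Hl2. apply Rabs_le. lra.
  - assert (Hbd := sol_flux_bound alpha beta gamma rho _ u Hb ltac:(lra) Hg Hs Hr0).
    apply Rle_trans with (/ (gamma + 1)); [|lra].
    apply (Rmult_le_compat_l (exp (- kappa * (- rho / theta)))) in Hbd;
      [|left; apply exp_pos].
    apply Rle_trans with (1 := Hbd). right.
    rewrite Rpower_exp. unfold Rdiv at 2.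
    replace (/ (gamma + 1)) with (exp 0 * / (gamma + 1)) at 2 by (rewrite exp_0; ring).
    (* Since $\gamma + 1 - \kappa = \theta$, the exponent vanishes at $t_0 = -\rho/\theta$, so
       $Z(t_0) \le 1/(\gamma+1)$. *)
    replace 0 with (- kappa * (- rho / theta) + rho + (gamma + 1) * (- rho / theta)).
    2: { unfold kappa. replace alpha with (gamma + 2 + beta - theta) by (unfold theta; ring). field. lra. }
    rewrite !exp_plus. ring.
Qed.

(** * Limits of the solutions, of their zeros and of the rescaled solutions *)

Theorem theorem1p8 (alpha beta gamma : R)
  (u : R -> R -> R) (Rz : R -> R)
  (Hab : alpha > beta + 1) (Hb : 0 <= beta)
  (Htheta : gamma + 2 + beta - alpha > 0)
  (Hsol : forall rho, 0 < rho -> is_sol_ivp alpha beta gamma rho (u rho))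
  (HRpos : forall rho, 0 < rho -> 0 < Rz rho)
  (HRzero : forall rho, 0 < rho -> u rho (Rz rho) = 0)
  (HRuniq : forall rho r, 0 < rho -> 0 < r -> u rho r = 0 -> r = Rz rho) :
  let theta := gamma + 2 + beta - alpha in
  let lam := fun rho => Rpower (Rz rho) theta in
  let lamstar := Rpower theta (beta + 1) * (alpha - beta - 1) in
  cvg_loc_unif_pinfty u (fun r => ln lamstar - theta * ln r) /\
  is_lim lam p_infty lamstar /\
  cvg_loc_unif_pinfty
    (fun rho r => u rho (Rpower (lam rho) (1 / theta) * r))
    (fun r => - theta * ln r).
Proof.
  intros theta lam lamstar. change (0 < theta) in Htheta.
  assert (Hls : 0 < lamstar) by (apply Rmult_lt_0_compat; [apply Rpower_gt_0 | lra]).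
  (* Uniformity on the whole half-line $[a,\infty)$ allows evaluation at [Rz rho], for which no
     upper bound is known beforehand. *)
  assert (Hunif : forall a eps, 0 < a -> 0 < eps -> exists M, 0 <= M /\
    forall rho, M < rho -> forall r, a <= r ->
    Rabs (u rho r - (ln lamstar - theta * ln r)) < eps).
  { intros a eps Ha Heps.
    destruct (sol_uniform_convergence alpha beta gamma eps Hb Hab Htheta Heps) as [T HT].
    fold theta in HT.
    replace ((alpha - beta - 1) * Rpower theta (beta + 1)) with lamstar in HT
      by (unfold lamstar; ring).
    exists (Rmax 0 (theta * (T - ln a))). split; [apply Rmax_l|].
    intros rho Hrho r Hr.
    assert (H0 := Rmax_l 0 (theta * (T - ln a))).
    assert (H1 := Rmax_r 0 (theta * (T - ln a))).
    apply (HT rho); [apply Hsol; lra | lra |].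
    apply Rle_trans with (ln a).
    - apply Rmult_le_reg_l with theta; [exact Htheta|].
      replace (theta * (T - rho / theta)) with (theta * T - rho) by (field; lra). lra.
    - destruct Hr as [Hr | <-]; [left; now apply ln_increasing | lra]. }
  (* [u* = 1] at [a0], so the zero of [u rho] eventually lies beyond [a0]. *)
  set (a0 := exp ((ln lamstar - 1) / theta)).
  assert (Ha0 : 0 < a0) by apply exp_pos.
  assert (Hzero : exists M0, 0 <= M0 /\ forall rho, M0 < rho -> a0 <= Rz rho).
  { destruct (Hunif a0 1 Ha0 Rlt_0_1) as [M [HM H]].
    exists M. split; [exact HM|]. intros rho Hrho.
    (* A zero before [a0] would give $u(a_0) \le 0$ by monotonicity, whereas $|u(a_0) - 1| < 1$. *)
    apply Rnot_lt_le. intros Hlt.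
    specialize (H rho Hrho a0 (Rle_refl _)). unfold a0 at 2 in H. rewrite ln_exp in H.
    replace (theta * ((ln lamstar - 1) / theta)) with (ln lamstar - 1) in H by (field; lra).
    apply Rabs_lt_between in H.
    assert (Hd := sol_decreasing alpha beta gamma rho (Rz rho) a0 (u rho) Hb
      ltac:(lra) (Hsol rho ltac:(lra)) (HRpos rho ltac:(lra)) ltac:(lra)).
    rewrite HRzero in Hd by lra. lra. }
  destruct Hzero as [M0 [HM0 Hzero]].
  assert (Hlnlam : forall eps, 0 < eps -> exists M, M0 <= M /\
    forall rho, M < rho -> Rabs (ln lamstar - theta * ln (Rz rho)) < eps).
  { intros eps Heps. destruct (Hunif a0 eps Ha0 Heps) as [M [HM H]].
    exists (Rmax M M0). split; [apply Rmax_r|]. intros rho Hrho.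
    assert (H1 := Rmax_l M M0). assert (H2 := Rmax_r M M0).
    specialize (H rho ltac:(lra) (Rz rho) (Hzero rho ltac:(lra))).
    rewrite HRzero in H by lra.
    rewrite <- Rabs_Ropp. now replace (- (ln lamstar - theta * ln (Rz rho)))
      with (0 - (ln lamstar - theta * ln (Rz rho))) by ring. }
  split; [|split].
  - intros a b Ha _ eps Heps. destruct (Hunif a eps Ha Heps) as [M [_ H]].
    exists M. intros rho Hrho r Hr. apply H; [exact Hrho | apply Hr].
  - assert (Hln : is_lim (fun rho => theta * ln (Rz rho)) p_infty (ln lamstar)).
    { apply is_lim_spec. intros eps.
      destruct (Hlnlam eps (cond_pos eps)) as [M [_ H]].
      exists M. intros rho Hrho. rewrite Rabs_minus_sym. now apply H. }
    (* [lam rho] unfolds to [exp (theta * ln (Rz rho))], so continuity of [exp] suffices. *)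
    rewrite <- (exp_ln lamstar Hls).
    apply (filterlim_comp _ _ _ (fun rho => theta * ln (Rz rho)) exp _ _ _ Hln).
    apply (ex_derive_continuous exp). eexists.
    apply is_derive_Reals, derivable_pt_lim_exp.
  - intros a b Ha _ eps Heps.
    (* One half of [eps] pays for $\ln\lambda^* - \theta\ln R$, the other for convergence at $R r
       \ge a_0 a$, with $R$ the zero. *)
    destruct (Hlnlam (eps / 2)) as [M1 [HM1 H1]]; [lra|].
    destruct (Hunif (a0 * a) (eps / 2)) as [M2 [HM2 H2]];
      [now apply Rmult_lt_0_compat | lra |].
    exists (Rmax M1 M2). intros rho Hrho r Hr.
    assert (HmL := Rmax_l M1 M2). assert (HmR := Rmax_r M1 M2).
    specialize (H1 rho ltac:(lra)).
    assert (HR := HRpos rho ltac:(lra)). assert (HRa := Hzero rho ltac:(lra)).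
    replace (Rpower (lam rho) (1 / theta)) with (Rz rho).
    2: { unfold lam, Rdiv. rewrite Rmult_1_l, Rpower_inv_l; lra. }
    specialize (H2 rho ltac:(lra) (Rz rho * r)
      ltac:(apply Rmult_le_compat; lra)).
    rewrite ln_mult in H2 by lra.
    apply Rabs_lt_between in H1. apply Rabs_lt_between in H2.
    apply Rabs_lt_between. lra.
Qed.
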